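(* Every directed path $P$ satisfies $\dim(P)\le 4$, and there exist directed paths $P$ with $\dim(P)=4$.
   Context: All digraphs are finite and have simple underlying graphs. A directed path is a digraph $v_1\to v_2\to\cdots\to v_m$ with vertex set $\{v_1,\dots,v_m\}$ and arc set exactly $\{(v_i,v_{i+1}):1\le i<m\}$. For an integer $d\ge 0$ write $[d]=\{1,\dots,d\}$ (with $\mathbb{R}^0=\{0\}$). For $x,y\in\mathbb{R}^d$ let $\mathcal{G}_{x>y}=\{i\in[d]: x_i>y_i\}$. The weak majority relation: $x\succ y$ iff $|\mathcal{G}_{x>y}|-|\mathcal{G}_{y>x}|>0$. A map $f:V(D)\to\mathbb{R}^d$ is an $\mathbb{R}^d$-realizer of $D$ if for all vertices $x,y$: $(x,y)\in A(D)$ iff $f(x)\succ f(y)$. The weak majority dimension $\dim(D)$ is the minimum nonnegative integer $d$ such that $D$ has an $\mathbb{R}^d$-realizer (such $d$ always exists). *)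

(* Defs.v *)
From mathcomp Require Import all_boot all_order all_algebra.
From mathcomp Require Import boolp reals.
Set Implicit Arguments.
Unset Strict Implicit.
Unset Printing Implicit Defensive.
Import Order.TTheory GRing.Theory Num.Theory.
Local Open Scope ring_scope.

(* Finite digraphs with simple underlying graph: the case x = y of
   [adj_asym] excludes loops. *)
Record digraph := Digraph {
  vertex :> finType;
  adj : rel vertex;
  adj_asym : forall x y, adj x y -> ~~ adj y x }.

Definition directed_path (D : digraph) : Prop :=
  exists m : nat, (0 < m)%N /\
  exists v : 'I_m -> D, bijective v /\
  forall i j : 'I_m, adj (v i) (v j) <-> nat_of_ord j = i.+1.

Section Majority.
Variable R : realType.

Definition gt_coords d (x y : 'rV[R]_d) : {set 'I_d} :=
  [set i | y 0 i < x 0 i].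

Definition weak_majority d (x y : 'rV[R]_d) : bool :=
  0 < #|gt_coords x y|%:Z - #|gt_coords y x|%:Z.

Definition is_realizer (D : digraph) d (f : D -> 'rV[R]_d) : Prop :=
  forall x y : D, adj x y <-> weak_majority (f x) (f y).

Definition realizable (D : digraph) (d : nat) : Prop :=
  exists f : D -> 'rV[R]_d, is_realizer f.

(* McGarvey's construction: each arc (u, v) contributes two coordinates,
   ranking u > v > (all others) and (all others) > u > v respectively; ties are
   allowed, so these cancel on every pair other than {u, v}. *)
Definition mcgarvey (D : digraph) (t : D * D * bool) (x : D) : nat :=
  let: (u, v, b) := t in
  (if adj u v then
     if x == u then if b then 2 else 1
     else if x == v then if b then 1 else 0
     else if b then 0 else 2
   else 0)%N.

Lemma mcgarvey_pair (D : digraph) (p : D * D) (x y : D) :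
  \sum_(b : bool) ((mcgarvey (p, b) y < mcgarvey (p, b) x)%N%:Z -
                   (mcgarvey (p, b) x < mcgarvey (p, b) y)%N%:Z) =
  2 * (adj p.1 p.2 && (p.1 == x) && (p.2 == y))%:Z
  - 2 * (adj p.1 p.2 && (p.1 == y) && (p.2 == x))%:Z.
Proof.
case: p => u v.
rewrite big_bool /= (eq_sym u x) (eq_sym v y) (eq_sym u y) (eq_sym v x).
case: ifP => // auv.
have nuv : u != v by apply/eqP => e; move: (adj_asym auv); rewrite e -{1}e auv.
have [->|xu] := eqVneq x u; have [->|yu] := eqVneq y u; rewrite ?(negPf nuv) //=.
- by case: (y == v).
- by case: (x == v).
- by case: (x == v); case: (y == v).
Qed.

Lemma realizable_ex (D : digraph) : exists d, `[< realizable D d >].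
Proof.
pose I : finType := (D * D * bool)%type.
exists #|{: I}|; apply/asboolP.
exists (fun x => \row_k (mcgarvey (enum_val k) x)%:R) => x y.
have card_gt (a b : D) :
    #|gt_coords (\row_(k < #|{: I}|) (mcgarvey (enum_val k) a)%:R)
                (\row_k (mcgarvey (enum_val k) b)%:R)|%:Z
    = \sum_(t : I) (mcgarvey t b < mcgarvey t a)%N%:Z.
  rewrite -sum1_card big_mkcond /= (big_morph Posz PoszD erefl).
  rewrite [RHS](reindex (@enum_val I predT)); last exact/onW_bij/enum_val_bij.
  by apply: eq_bigr => k _; rewrite inE !mxE ltr_nat; case: ifP.
have delta (a b : D) :
    \sum_(p : D * D) 2 * (adj p.1 p.2 && (p.1 == a) && (p.2 == b))%:Z
    = 2 * (adj a b)%:Z.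
  rewrite (bigD1 (a, b)) //= !eqxx !andbT big1 ?addr0 // => -[u v] /=.
  rewrite xpair_eqE -andbA => /negPf ->.
  by rewrite andbF.
rewrite /weak_majority !card_gt -sumrB.
have split_bool (F : I -> int) :
    \sum_t F t = \sum_(p : D * D) \sum_(b : bool) F (p, b).
  by rewrite pair_bigA /=; apply: eq_bigr => -[].
rewrite split_bool (eq_bigr _ (fun p _ => mcgarvey_pair p x y)) sumrB !delta.
case axy: (adj x y); first by rewrite (negPf (adj_asym axy)).
by case: (adj y x).
Qed.

Definition dim (D : digraph) : nat := ex_minn (realizable_ex D).

End Majority.

(* Main.v *)
(* Upper bound: a matching is the majority relation of two linear orders, and
   the arcs of a path split into two matchings.

   Lower bound: in R^3, two distinct balanced points agree in exactly one
   coordinate, and agreement in a given coordinate is an equivalence relation,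
   so by pigeonhole five pairwise balanced points all agree in one coordinate.
   On the path 0 -> ... -> 10, apply this to {0, 2, 4, 6, t} for t = 8, 9, 10:
   the coordinate is determined by 0 and 2, so 8, 9 and 10 share it. With only
   two coordinates left, majority is coordinatewise domination, which is
   transitive, yet 8 -> 10 is not an arc. *)
From mathcomp Require Import all_boot all_order all_algebra boolp reals zify.
Require Import Defs.
Import Order.TTheory GRing.Theory Num.Theory.

Set Implicit Arguments.
Unset Strict Implicit.
Unset Printing Implicit Defensive.

Section Realizers.
Variable R : realType.
Local Open Scope ring_scope.

(** * Majority as a sum of signs, and the upper bound *)

Lemma weak_majorityE d (x y : 'rV[R]_d) :
  weak_majority x y = (0 < \sum_i sgz (x 0 i - y 0 i)).
Proof.
have card_gt (a b : 'rV[R]_d) : #|gt_coords a b|%:Z = \sum_i ((b 0 i < a 0 i)%R : nat)%:Z.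
  rewrite -sum1_card big_mkcond /= (big_morph Posz PoszD erefl).
  by apply: eq_bigr => i _; rewrite inE; case: ifP.
rewrite /weak_majority !card_gt -sumrB; congr (_ < _).
apply: eq_bigr => i _.
case: ltgtP => [lt_yx|lt_xy|->]; last by rewrite !subrr sgz0.
- by rewrite gtr0_sgz ?subr_gt0.
- by rewrite ltr0_sgz ?subr_lt0.
Qed.

(** Padding with zero coordinates only adds ties. This lets the lower bound exclude dimension
    exactly 3 alone. *)
Lemma realizable_leq (D : digraph) d e :
  (d <= e)%N -> realizable R D d -> realizable R D e.
Proof.
move=> /subnKC <- [f fP]; exists (fun x => row_mx (f x) 0) => x y.
rewrite fP !weak_majorityE big_split_ord /=.
rewrite [X in _ + X]big1 ?addr0 => [|i _]; last first.
  by rewrite !row_mxEr subrr sgz0.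
by under [in X in _ <-> X]eq_bigr do rewrite !row_mxEl.
Qed.

Lemma dim_leq (D : digraph) d : realizable R D d -> (dim R D <= d)%N.
Proof. by move=> Dd; rewrite /dim; case: ex_minnP => n _; apply; apply/asboolP. Qed.

Lemma realizable_dim (D : digraph) : realizable R D (dim R D).
Proof. by rewrite /dim; case: ex_minnP => n /asboolP. Qed.

(* [4 * (n./2) - n] lists the blocks {2b, 2b+1} in increasing order but is
   decreasing inside each block, so paired with the decreasing order [- n] it
   cancels everywhere except on the arcs 2b -> 2b+1; the last two coordinates
   do the same for the arcs 2b+1 -> 2b+2. *)
Definition path_coords (n : nat) : 4.-tuple int :=
  [tuple - n%:Z; 4 * (n./2)%:Z - n%:Z; - n%:Z; 4 * (uphalf n)%:Z - n%:Z].

Lemma path_coords_score (i j : nat) :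
  (0 < \sum_(k < 4) sgz (tnth (path_coords i) k - tnth (path_coords j) k))
  = (j == i.+1).
Proof.
rewrite !big_ord_recl big_ord0 /tnth /=.
have [ei ej] := (odd_double_half i, odd_double_half j).
rewrite !uphalf_half.
(* Once the parities of [i] and [j] are fixed, every coordinate is linear in the halves [a] and
   [b]. *)
move: ei ej; case: (odd i); case: (odd j);
  move: (i./2) (j./2) => a b <- <- /=; lia.
Qed.

Lemma directed_path_realizable4 (P : digraph) :
  directed_path P -> realizable R P 4.
Proof.
move=> [m [_ [v [[w vK wK] vP]]]].
exists (fun x => \row_k (tnth (path_coords (w x)) k)%:~R) => x y.
rewrite -{1}(wK x) -{1}(wK y) vP weak_majorityE.
under eq_bigr do rewrite !mxE -rmorphB /= sgz_int.
by rewrite path_coords_score; split=> /eqP.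
Qed.

(** * Agreement and domination in three coordinates *)

Definition agree d (x y : 'rV[R]_d) : {set 'I_d} := [set i | x 0 i == y 0 i].

Lemma card_agree_eq d (x y : 'rV[R]_d) : #|agree x y| = d -> x = y.
Proof.
move=> card_xy; apply/rowP => i; apply/eqP.
suff /setP/(_ i) : agree x y = setT by rewrite !inE.
by apply/eqP; rewrite eqEcard subsetT cardsT card_ord card_xy leqnn.
Qed.

Lemma sgz_bound (a : R) : -1 <= sgz a <= 1.
Proof. by case: sgzP. Qed.

(** Three signs with sum zero contain one zero or three, and three zeros would force [x = y]. *)
Lemma card_agree_balanced (x y : 'rV[R]_3) :
  ~~ weak_majority x y -> ~~ weak_majority y x -> x != y ->
  #|agree x y| = 1%N.
Proof.
move=> nxy nyx neq_xy.
have neq3 : #|agree x y| != 3%N by apply: contra neq_xy => /eqP/card_agree_eq->.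
have sgz_sym i : sgz (y 0 i - x 0 i) = - sgz (x 0 i - y 0 i).
  by rewrite -opprB sgzN.
move: nxy nyx neq3; rewrite !weak_majorityE (eq_bigr _ (fun i _ => sgz_sym i)).
have -> : #|agree x y| = (\sum_i ((sgz (x 0 i - y 0 i) == 0)%R : nat))%N.
  rewrite -sum1_card big_mkcond /=.
  by apply: eq_bigr => i _; rewrite inE sgz_eq0 subr_eq0; case: ifP.
move: (fun i => sgz_bound (x 0 i - y 0 i)).
move: (fun i => sgz (x 0 i - y 0 i)) => s s_bound.
move: (s_bound ord0) (s_bound (lift ord0 ord0)) (s_bound (lift ord0 (lift ord0 ord0))).
rewrite !big_ord_recl !big_ord0; lia.
Qed.

Lemma agree_majority_le (x y : 'rV[R]_3) k i :
  weak_majority x y -> k \in agree x y -> y 0 i <= x 0 i.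
Proof.
rewrite weak_majorityE inE => gt_xy /eqP eq_k; rewrite leNgt; apply/negP => lt_i.
have neq_ik : i != k by apply: contraTneq lt_i => ->; rewrite eq_k ltxx.
have sum_delta (l : 'I_3) : \sum_j ((j == l) : nat)%:Z = 1.
  by rewrite (bigD1 l) //= eqxx big1 ?addr0 // => j /negPf ->.
(* The bound is 0 at [k], -1 at [i] and 1 at the third coordinate, so its total is 0. *)
suff : \sum_j sgz (x 0 j - y 0 j) <=
       \sum_j (1 - ((j == k) : nat)%:Z - 2 * ((j == i) : nat)%:Z).
  by rewrite !sumrB -mulr_sumr !sum_delta sumr_const card_ord leNgt gt_xy.
apply: ler_sum => j _; have [->|neq_jk] := eqVneq j k.
  by rewrite eq_k subrr sgz0 eq_sym (negPf neq_ik).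
have [->|neq_ji] := eqVneq j i; first by rewrite ltr0_sgz ?subr_lt0.
by case/andP: (sgz_bound (x 0 j - y 0 j)).
Qed.

Lemma weak_majority_dominates d (x y : 'rV[R]_d) :
  (forall i, y 0 i <= x 0 i) -> x != y -> weak_majority x y.
Proof.
move=> le_yx neq_xy; rewrite weak_majorityE lt_neqAle eq_sym.
have s_ge0 i : true -> 0 <= sgz (x 0 i - y 0 i) by rewrite sgz_ge0 subr_ge0.
rewrite sumr_ge0 // andbT; apply: contra neq_xy => /eqP/psumr_eq0P s0.
apply/eqP/rowP => i; apply/eqP; rewrite -subr_eq0 -sgz_eq0.
by rewrite s0.
Qed.

(** * Pigeonhole on agreement coordinates *)

Section Monochromatic.
Variables (T : finType) (f : T -> 'rV[R]_3) (S : {set T}).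
Hypothesis agree1 : {in S &, forall x y, x != y -> #|agree (f x) (f y)| = 1%N}.

Lemma agree_unique x y k l : x \in S -> y \in S -> x != y ->
  k \in agree (f x) (f y) -> l \in agree (f x) (f y) -> k = l.
Proof.
move=> Sx Sy neq_xy; have /eqP/cards1P[m ->] := agree1 Sx Sy neq_xy.
by rewrite !inE => /eqP-> /eqP->.
Qed.

Lemma agree_choice x : x \in S ->
  exists c : T -> 'I_3, {in S :\ x, forall y, c y \in agree (f x) (f y)}.
Proof.
(* The default [ord0] is never reached on [S :\ x], where the agreement set is a singleton. *)
move=> Sx; exists (fun y => odflt ord0 [pick k in agree (f x) (f y)]) => y.
rewrite in_setD1 => /andP[neq_yx Sy]; case: pickP => [k //|agree0] /=.
have := agree1 Sx Sy; rewrite eq_sym neq_yx => /(_ isT).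
by rewrite (eq_card0 agree0).
Qed.

(* If the common coordinates [c v] of [w] with the points [v] of [A] all avoided
   [k], two of them would coincide, giving two points of [A] that agree both
   in [k] and in another coordinate. *)
Lemma agree_extend (A : {set T}) k x w :
  A \subset S -> (2 < #|A|)%N -> {in A &, forall u v, f u 0 k = f v 0 k} ->
  x \in A -> w \in S -> f x 0 k = f w 0 k.
Proof.
move=> /subsetP sAS gt2 Ak Ax Sw.
have [Aw|nAw] := boolP (w \in A); first exact: Ak.
apply/eqP; apply: contraTT gt2 => neq_k; have [c cP] := agree_choice Sw.
have cE v : v \in A -> f w 0 (c v) = f v 0 (c v).
  move=> Av; apply/eqP; have := cP v; rewrite !inE sAS // andbT; apply.
  by apply: contraNneq nAw => <-.
have c_neq v : v \in A -> c v != k.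
  move=> Av; apply: contra neq_k => /eqP cv.
  by rewrite (Ak x v) // -cv cE.
suff c_inj : {in A &, injective c}.
  rewrite -leqNgt -(card_in_imset c_inj).
  apply: (@leq_trans #|[set~ k]|); last by rewrite cardsC1 card_ord.
  apply/subset_leq_card/subsetP => _ /imsetP[v Av ->].
  by rewrite !inE c_neq.
move=> u v Au Av eq_c; apply/eqP; apply: contraNT (c_neq u Au) => neq_uv.
apply/eqP; apply: (agree_unique (sAS u Au) (sAS v Av) neq_uv); rewrite inE.
- by rewrite -cE // eq_c cE.
- by rewrite (Ak u v).
Qed.

(** A point [x] has at least four partners for three coordinates, so two of them, [y] and [z], agree
    with [x] in the same one. The triple [x], [y], [z] then extends to all of [S]. *)
Lemma agree_monochromatic : (4 < #|S|)%N ->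
  exists k, {in S &, forall x y, f x 0 k = f y 0 k}.
Proof.
move=> gt4; have /card_gt0P[x Sx] : (0 < #|S|)%N by apply: leq_trans gt4.
have [c cP] := agree_choice Sx.
have /dinjectivePn[y Sy [z]] : ~~ dinjectiveb c (S :\ x).
  apply: contraL gt4 => /dinjectiveP/leq_card_in; rewrite card_ord.
  by rewrite (cardsD1 x S) Sx -leqNgt.
rewrite inE /= => /andP[nzy Sz] eq_c; exists (c y).
have := cP z Sz; have := cP y Sy; rewrite -eq_c !inE => /eqP xy /eqP xz.
move: Sy Sz; rewrite !in_setD1 => /andP[nyx Sy] /andP[nzx Sz].
suff xw w : w \in S -> f x 0 (c y) = f w 0 (c y) by move=> u v Su Sv; rewrite -!xw.
apply: (@agree_extend [set x; y; z]); last by rewrite !inE eqxx.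
- by rewrite !subUset !sub1set Sx Sy Sz.
- by rewrite setUC cardsU1 cards2 !inE negb_or nzx nzy eq_sym nyx.
- by move=> u v; rewrite !inE -!orbA => /or3P[] /eqP-> /or3P[] /eqP->; rewrite -?xy -?xz.
Qed.

End Monochromatic.

End Realizers.

Fact path11_asym (i j : 'I_11) :
  nat_of_ord j == i.+1 -> ~~ (nat_of_ord i == j.+1).
Proof. lia. Qed.

(** Eleven vertices leave room for 0, 2, 4, 6 followed by the consecutive 8, 9, 10, none of them
    adjacent to the first four. *)
Definition path11 : digraph := Digraph path11_asym.

Lemma path11_directed : directed_path path11.
Proof.
exists 11; split=> //; exists id; split; first by exists id.
by move=> i j; split=> /eqP.
Qed.

Lemma path11_not_realizable3 (R : realType) : ~ realizable R path11 3.
Proof.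
move=> [f fP]; pose v (n : nat) : path11 := (inord n : 'I_11).
have vK n : n < 11 -> nat_of_ord (v n) = n by move=> ?; rewrite /v inordK.
(* Points with equal images have the same out-neighbours, and on a path a successor determines its
   vertex; only vertex 10 has none. *)
have f_inj : injective f.
  have twin (i j : 'I_11) : f i = f j -> i < 10 -> i = j.
    move=> eq_f lt_i.
    have [_] := fP j (v i.+1); rewrite -eq_f => /(_ (proj1 (fP i (v i.+1)) _)).
    by rewrite /= vK // => /(_ (eqxx _))/eqP[e]; apply/val_inj.
  move=> i j eq_f; have [lt_i|ge_i] := ltnP i 10; first exact: twin.
  have [lt_j|ge_j] := ltnP j 10; first by apply/esym/twin.
  by apply/val_inj => /=; have := ltn_ord i; have := ltn_ord j; lia.
have wmP (i j : 'I_11) : weak_majority (f i) (f j) = (nat_of_ord j == i.+1).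
  by apply/idP/idP => /fP.
have agree1 (i j : 'I_11) : i != j -> nat_of_ord j != i.+1 ->
    nat_of_ord i != j.+1 -> #|agree (f i) (f j)| = 1.
  move=> nij nj ni; apply: card_agree_balanced; rewrite ?wmP //.
  by rewrite (inj_eq f_inj).
pose S t : {set 'I_11} := [set v 0; v 2; v 4; v 6; v t].
have mono t : 8 <= t < 11 -> exists k, {in S t &, forall x y, f x 0%R k = f y 0%R k}.
  move=> /andP[ge8 lt11].
  apply: agree_monochromatic => [x y|].
    by rewrite !inE -!orbA => /or4P[|||/orP[]] /eqP-> /or4P[|||/orP[]] /eqP-> nxy;
       apply: agree1; rewrite ?vK //; move: nxy; rewrite -?val_eqE /= ?vK //; lia.
  have -> : #|S t| = size [:: v 0; v 2; v 4; v 6; v t].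
    rewrite -(card_uniqP _); first by apply: eq_card => x; rewrite !inE -!orbA.
    by rewrite /= !inE -!val_eqE /= !vK //; lia.
  by [].
have agree02 : #|agree (f (v 0)) (f (v 2))| = 1.
  by apply: agree1; rewrite -?val_eqE /= !vK.
have /eqP/cards1P[k0 agree02E] := agree02.
have common t : 8 <= t < 11 -> f (v t) 0%R k0 = f (v 0) 0%R k0.
  move=> t_bd; have [k kP] := mono t t_bd.
  suff -> : k0 = k by apply: kP; rewrite !inE eqxx ?orbT.
  have : k \in agree (f (v 0)) (f (v 2)) by rewrite inE; apply/eqP/kP; rewrite !inE eqxx ?orbT.
  by rewrite agree02E inE => /eqP.
have step t : 8 <= t < 10 -> forall i, (f (v t.+1) 0%R i <= f (v t) 0%R i)%R.
  move=> t_bd i; apply: (@agree_majority_le _ _ _ k0); first by rewrite wmP !vK //; lia.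
  by rewrite inE !common //; lia.
have : weak_majority (f (v 8)) (f (v 10)).
  apply: weak_majority_dominates => [i|].
    by apply: le_trans (step 8 isT i); apply: step.
  by rewrite (inj_eq f_inj) -val_eqE /= !vK.
by rewrite wmP !vK.
Qed.

Theorem theorem4p3 (R : realType) :
  (forall P : digraph, directed_path P -> dim R P <= 4) /\
  (exists P : digraph, directed_path P /\ dim R P = 4).
Proof.
split=> [P /(directed_path_realizable4 R)/dim_leq //|].
exists path11; split; first exact: path11_directed.
apply/eqP; rewrite eqn_leq dim_leq /=; last exact/directed_path_realizable4/path11_directed.
rewrite leqNgt; apply/negP => lt4; apply: (@path11_not_realizable3 R).
(* By conversion [lt4] also says that the dimension is at most 3. *)
exact: (@realizable_leq _ _ _ 3 lt4 (realizable_dim R path11)).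
Qed.
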